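(* Let $\{K_n\}$ be the Markov chain on $\{1,2,3,\ldots\}$ of the numbers of customers served in successive stages of the synchronized gated $GI/M/\infty$ system, i.e. the chain with transition probabilities $$P_{ij}=\mathbb{P}\left(S_{j-1}<\max(\sigma_1,\ldots,\sigma_i)\le S_j\right),\qquad i,j=1,2,\ldots,$$ where $S_0=0$, $S_j=\tau_1+\cdots+\tau_j$, the $\tau_m$ are i.i.d. positive random variables, and the $\sigma_m$ are i.i.d. exponential random variables with rate $\mu>0$, independent of $\{\tau_m\}$. Suppose that the interarrival times have finite second moment, $\mathbb{E}\tau_1^2<\infty$. Then $\{K_n\}$ is positive recurrent and its invariant distribution $\{\pi_i\}$ satisfies $$\pi_i=\sum_{j=1}^\infty\pi_jP_{ji},\quad i=1,2,3,\ldots,\qquad \sum_{i=1}^\infty\pi_i=1.$$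
   Context: Synchronized gated $GI/M/\infty$ system: customers arrive according to a renewal process $\{S_m\}$ with i.i.d. positive interarrival times $\tau_m$. All customers admitted when the gate opens are served in parallel, with independent exponential($\mu$) service times. After all of them have completed service, the gate stays closed until the next arrival epoch, when all customers who arrived since the previous opening (including the one just arriving) are admitted, starting a new stage. Hence, given that a stage serves $i$ customers, the next stage serves $j$ customers with probability $P_{ij}$. *)

(* Defs.v *)
From HB Require Import structures.
From mathcomp Require Import all_boot all_order all_algebra.
From mathcomp Require Import all_classical all_reals all_analysis.

Set Implicit Arguments.
Unset Strict Implicit.
Unset Printing Implicit Defensive.

Import Order.TTheory GRing.Theory Num.Theory.
Import numFieldNormedType.Exports.

Local Open Scope classical_set_scope.
Local Open Scope ring_scope.
Local Open Scope ereal_scope.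

Section RandomVariables.
Context d (T : measurableType d) (R : realType) (P : probability T R).

(* Mutual independence: product rule over every finite subfamily [J]. *)
Definition mutually_independent (I : choiceType) (X : I -> {RV P >-> R}) : Prop :=
  forall (J : seq I) (B : I -> set R), uniq J -> (forall k, measurable (B k)) ->
    P (\bigcap_(k in [set` J]) (X k @^-1` B k)) =
    \prod_(k <- J) P (X k @^-1` B k).

Definition same_law (X Y : {RV P >-> R}) : Prop :=
  forall A : set R, measurable A -> distribution P X A = distribution P Y A.

Definition exponential_law (mu : R) (X : {RV P >-> R}) : Prop :=
  forall A : set R, measurable A -> distribution P X A = exponential_prob mu A.

(* The sequences tau_1, tau_2, ... and sigma_1, sigma_2, ... are indexed from 0:
   [tau m] is tau_(m+1) and [sigma m] is sigma_(m+1). *)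
Definition arrival_epoch (tau : nat -> {RV P >-> R}) (j : nat) (w : T) : R :=
  (\sum_(m < j) tau m w)%R.

(* max(sigma_1, ..., sigma_i) for i >= 1: seeding the iterated maximum with
   [sigma 0] is harmless because it is one of the terms. *)
Definition stage_duration (sigma : nat -> {RV P >-> R}) (i : nat) (w : T) : R :=
  \big[Num.max/sigma 0%N w]_(m < i) sigma m w.

(* Meaningful for i, j >= 1; 0 is not a state of the chain. *)
Definition stage_transition (tau sigma : nat -> {RV P >-> R}) (i j : nat) : \bar R :=
  P [set w | (arrival_epoch tau j.-1 w < stage_duration sigma i w)%R /\
             (stage_duration sigma i w <= arrival_epoch tau j w)%R].

End RandomVariables.

(* Markov chains on the state space {1, 2, 3, ...}, encoded as the nonzero
   elements of nat, presented as a process [K] on a measurable space carrying a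
   family of laws: [Pr i] is the law of the chain started from the state i. *)
Section MarkovChains.
Context d (T : measurableType d) (R : realType).
Implicit Types (p : nat -> nat -> \bar R) (Pr : nat -> probability T R)
  (K : nat -> {mfun T >-> nat}).

(* The last clause is the Markov property
   P(K_(n+1) = x_(n+1) | K_0 = x_0, ..., K_n = x_n) = p x_n x_(n+1),
   multiplied out so that null conditioning events need no special treatment. *)
Definition is_markov_chain p Pr K : Prop :=
  (forall n w, (0 < K n w)%N) /\
  forall i : nat, (0 < i)%N ->
    Pr i [set w | K 0%N w = i] = 1 /\
    forall (n : nat) (x : nat -> nat), (forall m, (0 < x m)%N) ->
      Pr i [set w | forall m, (m <= n.+1)%N -> K m w = x m] =
      Pr i [set w | forall m, (m <= n)%N -> K m w = x m] * p (x n) (x n.+1).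

(* inf {n >= 1 : K_n = i}, equal to +oo if the chain never visits i after time 0. *)
Definition return_time K (i : nat) (w : T) : \bar R :=
  ereal_inf [set (n%:R)%:E | n in [set n : nat | (0 < n)%N /\ K n w = i]].

Definition positive_recurrent Pr K : Prop :=
  forall i : nat, (0 < i)%N ->
    Pr i [set w | return_time K i w < +oo] = 1 /\
    \int[Pr i]_w return_time K i w < +oo.

(* The value [q 0] plays no role. *)
Definition invariant_distribution p (q : nat -> R) : Prop :=
  [/\ forall i : nat, (0 < i)%N -> (0 <= q i)%R,
      forall i : nat, (0 < i)%N -> (q i)%:E = \sum_(1 <= j <oo) (q j)%:E * p j i
    & \sum_(1 <= i <oo) (q i)%:E = 1].

End MarkovChains.

(* Main.v *)
Require Import Defs.
From HB Require Import structures.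
From mathcomp Require Import all_boot all_order all_algebra.
From mathcomp Require Import all_classical all_reals all_analysis.
From mathcomp Require Import measurable_realfun ring lra.

Set Implicit Arguments.
Unset Strict Implicit.
Unset Printing Implicit Defensive.

Import Order.TTheory GRing.Theory Num.Theory.
Import numFieldNormedType.Exports.

Local Open Scope classical_set_scope.
Local Open Scope ring_scope.
Local Open Scope ereal_scope.

(* Only the tail bound P(S_j < sigma_m) <= phi^j with phi < 1 is needed from the
   queue. By a union bound P(S_j < max(sigma_1, ..., sigma_i)) <= i phi^j, so the
   number of customers in the next stage has conditional mean at most
   J + i phi^J / (1 - phi) for every J, hence at most J + i / 2 for J large: this is
   Foster's drift condition for the Lyapunov function V(i) = i. As all transition
   probabilities are positive, drift gives a bound on the survival probabilities of
   the chain killed at a given state, hence positive recurrence; the expected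
   occupation measure of an excursion, normalised, is invariant; and it is unique
   because the minimum of two invariant distributions is again invariant. *)

(** * Nonnegative series and kernels *)

Section Series.
Context {R : realType}.
Implicit Types f g : nat -> \bar R.

(** The factor may be [+oo]: then both sides are [+oo] as soon as one term is positive, and 0
    otherwise. *)
Lemma ge0_nneseriesZl f c : 0 <= c -> (forall i, 0 <= f i) ->
  \sum_(i <oo) c * f i = c * \sum_(i <oo) f i.
Proof.
case: c => [r _ f0|_ f0|//]; first by rewrite nneseriesZl// => i _; exact: f0.
have [[k fk]|/forallNP fn] := pselect (exists k, 0 < f k).
  have sk : 0 < \sum_(i <oo) f i.
    rewrite (@nneseriesD1 _ _ k)//; apply: lt_le_trans fk _.
    by rewrite leeDl// nneseries_ge0.
  rewrite gt0_mulye// (@nneseries_pinfty _ _ xpredT k)//.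
    by move=> n _; rewrite mule_ge0.
  by rewrite gt0_mulye.
have f00 i : f i = 0.
  by apply/eqP; rewrite eq_le f0 andbT leNgt; apply/negP/fn.
rewrite !eseries0 ?mule0// => i _ _; by rewrite f00 ?mule0.
Qed.

(** The sum of [f] over all indices but one is finite and at most that of [g], so it can be
    cancelled from the equal totals. *)
Lemma eq_nneseries_sum_le f g : (forall i, 0 <= f i <= g i) ->
  \sum_(i <oo) f i = \sum_(i <oo) g i -> \sum_(i <oo) f i < +oo -> f =1 g.
Proof.
move=> fg; have f0 i : 0 <= f i by case/andP: (fg i).
have g0 i : 0 <= g i by case/andP: (fg i) => /le_trans h /h.
move=> e sf k; apply/eqP; rewrite eq_le; case/andP: (fg k) => _ -> /=.
move: e sf; rewrite (@nneseriesD1 _ _ k)// [in X in _ = X](@nneseriesD1 _ _ k)//.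
set a := \sum_(_ <oo | _) f _; set b := \sum_(_ <oo | _) g _ => e sf.
have ab : a <= b by apply: lee_nneseries => // n _; case/andP: (fg n).
have a0 : 0 <= a by apply: nneseries_ge0.
have fa : a \is a fin_num.
  by rewrite ge0_fin_numE//; apply: le_lt_trans sf; rewrite leeDr.
have : a + g k <= a + f k by rewrite [leRHS]addeC e addeC leeD2l.
by rewrite leeD2lE.
Qed.

End Series.

Section Kernels.
Context {R : realType}.
Implicit Types (f g v : nat -> \bar R) (Q : nat -> nat -> \bar R).

(** Matrix action on functions (columns); [kernel_push] is the action on measures (rows). *)
Definition kernel_act Q f k := \sum_(j <oo) Q k j * f j.
Definition kernel_push v Q k := \sum_(j <oo) v j * Q j k.

Lemma kernel_act_ge0 Q f : (forall i j, 0 <= Q i j) -> (forall i, 0 <= f i) ->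
  forall k, 0 <= kernel_act Q f k.
Proof. by move=> Q0 f0 k; apply: nneseries_ge0 => n _ _; exact: mule_ge0. Qed.

Lemma kernel_push_ge0 Q v : (forall i j, 0 <= Q i j) -> (forall i, 0 <= v i) ->
  forall k, 0 <= kernel_push v Q k.
Proof. by move=> Q0 f0 k; apply: nneseries_ge0 => n _ _; exact: mule_ge0. Qed.

Lemma kernel_pairing v Q f : (forall i, 0 <= v i) -> (forall i j, 0 <= Q i j) ->
  (forall i, 0 <= f i) ->
  \sum_(k <oo) kernel_push v Q k * f k = \sum_(j <oo) v j * kernel_act Q f j.
Proof.
move=> v0 Q0 f0.
transitivity (\sum_(k <oo) \sum_(j <oo) v j * Q j k * f k).
  apply: eq_eseriesr => k _; rewrite muleC -ge0_nneseriesZl//.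
    by apply: eq_eseriesr => j _; rewrite muleC.
  by move=> j; exact: mule_ge0.
rewrite nneseries_interchange; last by move=> j k; rewrite !mule_ge0.
apply: eq_eseriesr => j _; rewrite -ge0_nneseriesZl//.
  by apply: eq_eseriesr => k _; rewrite muleA.
by move=> k; exact: mule_ge0.
Qed.

Lemma kernel_push_mass v Q : (forall i, 0 <= v i) -> (forall i j, 0 <= Q i j) ->
  \sum_(k <oo) kernel_push v Q k = \sum_(j <oo) v j * \sum_(k <oo) Q j k.
Proof.
move=> v0 Q0; rewrite nneseries_interchange; last by move=> j k; exact: mule_ge0.
by apply: eq_eseriesr => j _; rewrite ge0_nneseriesZl.
Qed.

(** For a substochastic [Q]: the probability, from each starting state, that the chain killed by the
    missing mass is alive after [n] steps, written by first-step analysis. *)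
Fixpoint kernel_survival Q n : nat -> \bar R :=
  if n is m.+1 then kernel_act Q (kernel_survival Q m) else cst 1.

Fixpoint kernel_iter Q v n : nat -> \bar R :=
  if n is m.+1 then kernel_push (kernel_iter Q v m) Q else v.

Lemma kernel_survival_ge0 Q : (forall i j, 0 <= Q i j) ->
  forall n k, 0 <= kernel_survival Q n k.
Proof. by move=> Q0; elim=> [//|n ih] k; exact: kernel_act_ge0. Qed.

Lemma kernel_iter_ge0 Q v : (forall i j, 0 <= Q i j) -> (forall i, 0 <= v i) ->
  forall n k, 0 <= kernel_iter Q v n k.
Proof. by move=> Q0 v0; elim=> [//|n ih] k; exact: kernel_push_ge0. Qed.

Section Lyapunov.
Variables (Q : nat -> nat -> \bar R) (W : nat -> \bar R).
Hypotheses (Q_ge0 : forall i j, 0 <= Q i j) (W_ge0 : forall k, 0 <= W k).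
Hypothesis drift : forall k, 1 + kernel_act Q W k <= W k.

(** Induction on the number of terms: a first step turns [m.+1] terms into 1 plus [Q] applied to the
    first [m], and [drift] closes the bound. *)
Lemma kernel_survival_sum_le k : \sum_(n <oo) kernel_survival Q n k <= W k.
Proof.
apply: lime_le; first by apply: is_cvg_nneseries => n _ _; exact: kernel_survival_ge0.
apply: nearW => m; elim: m k => [|m ih] k; first by rewrite big_geq.
apply: le_trans (drift k); rewrite big_nat_recl// leeD2l// -nneseries_sum_nat.
  apply: lee_nneseries => [j _ _|j _].
    by apply: sume_ge0 => n _; rewrite mule_ge0// kernel_survival_ge0.
  by rewrite -ge0_sume_distrr ?lee_wpmul2l// => n _; exact: kernel_survival_ge0.
by move=> n j; rewrite mule_ge0// kernel_survival_ge0.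
Qed.

Lemma kernel_iter_mass_le v : (forall k, 0 <= v k) ->
  \sum_(n <oo) \sum_(k <oo) kernel_iter Q v n k <= \sum_(k <oo) v k * W k.
Proof.
move=> v0; have it0 := kernel_iter_ge0 Q_ge0 v0.
apply: lime_le; first by apply: is_cvg_nneseries => n _ _; exact: nneseries_ge0.
apply: nearW => m.
(* The integral of [W] against the current iterate has to be kept: by [drift] it pays for the mass
   of this iterate and for its own next value. *)
suff : \sum_(0 <= n < m) \sum_(k <oo) kernel_iter Q v n k +
   \sum_(k <oo) kernel_iter Q v m k * W k <= \sum_(k <oo) v k * W k.
  by apply: le_trans; rewrite leeDl// nneseries_ge0// => k _ _; exact: mule_ge0.
elim: m => [|m ih]; first by rewrite big_geq ?add0e.
apply: le_trans ih; rewrite big_nat_recr//= -addeA leeD2l//.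
rewrite kernel_pairing// -nneseriesD//; last first.
  by move=> j _ _; rewrite mule_ge0// kernel_act_ge0.
apply: lee_nneseries => [j _ _|j _].
  by rewrite adde_ge0// mule_ge0// kernel_act_ge0.
rewrite -[X in X + _]mule1 -ge0_muleDr// ?kernel_act_ge0//.
exact: lee_wpmul2l.
Qed.

End Lyapunov.
End Kernels.

(** * Foster's criterion *)

Section Foster.
Context {R : realType}.
Variables (p : nat -> nat -> \bar R) (V : nat -> R) (N : nat) (C : R).
Hypotheses (p_gt0 : forall i j, 0 < p i j)
  (p_sum1 : forall i, \sum_(j <oo) p i j = 1) (V_ge0 : forall k, (0 <= V k)%R).
Hypothesis drift : forall k,
  kernel_act p (EFin \o V) k <= (if (k < N)%N then C else V k - 1)%:E.

(** Only entries into [i] are erased; exits are kept, so that a chain started from [i] is killed at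
    its first return. *)
Definition taboo (i k j : nat) : \bar R := if j == i then 0 else p k j.

Let p_ge0 i j : 0 <= p i j. Proof. exact: ltW. Qed.

Let taboo_ge0 i k j : 0 <= taboo i k j.
Proof. by rewrite /taboo; case: ifP. Qed.

Lemma taboo_sum i k : \sum_(j <oo) taboo i k j + p k i = 1.
Proof.
rewrite -(p_sum1 k) [in RHS](@nneseriesD1 _ _ i)// addeC; congr (_ + _).
rewrite [RHS]eseries_mkcondr.
by apply: eq_eseriesr => j _; rewrite /taboo; case: eqP.
Qed.

Let p_fin i j : p i j \is a fin_num.
Proof.
rewrite ge0_fin_numE// (@le_lt_trans _ _ 1) ?ltry//.
by rewrite -(taboo_sum j i) leeDr// nneseries_ge0.
Qed.

Lemma finite_minorization i n :
  exists2 b : R, (0 < b)%R & forall k, (k < n)%N -> b%:E <= p k i.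
Proof.
elim: n => [|n [b b0 ih]]; first by exists 1%R.
exists (Num.min b (fine (p n i))).
  by rewrite lt_min b0 -lte_fin fineK ?p_fin ?p_gt0.
move=> k; rewrite ltnS leq_eqVlt => /predU1P[->|kn].
  by rewrite -[leRHS]fineK// lee_fin ge_min lexx orbT.
by apply: le_trans (ih _ kn); rewrite lee_fin ge_min lexx.
Qed.

(* Adding a large constant to [V] makes the drift condition hold on the finite
   set as well, because the taboo kernel loses mass there. *)
Lemma taboo_lyapunov i : exists2 W : nat -> R, (forall k, (0 <= W k)%R) &
  forall k, 1 + kernel_act (taboo i) (EFin \o W) k <= (W k)%:E.
Proof.
have [b b0 pb] := finite_minorization i N.
(* For [k < N] the taboo kernel loses mass at least [b], hence at least [A * b] after the shift of
   [V] by [A]; this pays for [C] and for the extra 1. *)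
set A := ((`|C| + 1) / b)%R.
have A0 : (0 <= A)%R by rewrite divr_ge0// ?addr_ge0// ltW.
exists (fun k => V k + A)%R => [k|k]; first exact: addr_ge0.
have -> : kernel_act (taboo i) (EFin \o (fun k => V k + A)%R) k =
    kernel_act (taboo i) (EFin \o V) k + A%:E * \sum_(j <oo) taboo i k j.
  rewrite -ge0_nneseriesZl ?lee_fin// -nneseriesD; last 2 first.
  - by move=> j _ _; rewrite mule_ge0 ?lee_fin.
  - by move=> j _ _; rewrite mule_ge0 ?lee_fin.
  apply: eq_eseriesr => j _ /=.
  by rewrite EFinD ge0_muleDr ?lee_fin// [A%:E * _]muleC.
have : kernel_act (taboo i) (EFin \o V) k <= kernel_act p (EFin \o V) k.
  apply: lee_nneseries => [j _ _|j _]; first by rewrite mule_ge0 ?lee_fin.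
  by rewrite lee_wpmul2r ?lee_fin// /taboo; case: ifP.
move=> /le_trans/(_ (drift k)).
have : 0 <= kernel_act (taboo i) (EFin \o V) k.
  by apply: kernel_act_ge0 => // j; rewrite /= lee_fin.
have := taboo_sum i k.
have : 0 <= \sum_(j <oo) taboo i k j by apply: nneseries_ge0.
have := pb k; rewrite -(fineK (p_fin k i)).
have : 0 <= p k i by []; rewrite -{1}(fineK (p_fin k i)).
move: (kernel_act _ _ _) (\sum_(j <oo) _) (fine _) => [x| |]// [s| |]// r.
rewrite -!EFinD !lee_fin => r0 br s0 [sr] x0 xC.
have -> : (s = 1 - r)%R by lra.
case: ifP br xC => [_ /(_ isT)|_ _ xC].
  move=> br xC.
  have : (A * b <= A * r)%R by rewrite ler_wpM2l.
  rewrite /A mulfVK ?gt_eqF// -/A.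
  have := ler_norm C; have := V_ge0 k; nra.
by have : (0 <= A * r)%R; [exact: mulr_ge0|nra].
Qed.

(** For [k = i] this sum of tail probabilities will bound the mean return time to [i]. *)
Lemma taboo_survival_sum_lty i k : \sum_(n <oo) kernel_survival (taboo i) n k < +oo.
Proof.
have [W W0 dW] := taboo_lyapunov i.
have W0' j : 0 <= (EFin \o W) j by rewrite /= lee_fin.
by rewrite (le_lt_trans (kernel_survival_sum_le (taboo_ge0 i) W0' dW k))//= ltry.
Qed.

Let start (i k : nat) : \bar R := if k == i then 1 else 0.

Let start_ge0 i k : 0 <= start i k. Proof. by rewrite /start; case: ifP. Qed.

Let start_sum i (f : nat -> \bar R) : (forall k, 0 <= f k) ->
  \sum_(k <oo) start i k * f k = f i.
Proof.
move=> f0; rewrite (@nneseriesD1 _ _ i)//; last by move=> k _; exact: mule_ge0.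
rewrite /start eqxx mul1e eseries0 ?adde0// => k _ /=.
by move=> /negbTE ->; rewrite mul0e.
Qed.

(* The expected number of visits to [k] during an excursion from [0]. *)
Let nu k := \sum_(n <oo) kernel_iter (taboo 0%N) (start 0%N) n k.

Let nu_ge0 k : 0 <= nu k.
Proof. by apply: nneseries_ge0 => n _ _; exact: kernel_iter_ge0. Qed.

(** The total mass is the mean length of an excursion, bounded by the Lyapunov function at 0. *)
Let nu_mass_lty : \sum_(k <oo) nu k < +oo.
Proof.
have [W W0 dW] := taboo_lyapunov 0%N.
have W0' k : 0 <= (EFin \o W) k by rewrite /= lee_fin.
rewrite nneseries_interchange; last by move=> k n; exact: kernel_iter_ge0.
have := kernel_iter_mass_le (taboo_ge0 0%N) W0' dW (start_ge0 0%N).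
by move=> /le_lt_trans; apply; rewrite start_sum// ltry.
Qed.

(** The term [n = 0] is the start of the excursion; every later visit is reached by one taboo step
    from the preceding position. *)
Let nuE k : nu k = start 0%N k + kernel_push nu (taboo 0%N) k.
Proof.
rewrite /nu nneseries_recl//; last by move=> n _; exact: kernel_iter_ge0.
congr (_ + _); rewrite -nneseries_addn; last by move=> n; exact: kernel_iter_ge0.
under eq_eseriesr do rewrite addn1 /=.
rewrite /kernel_push nneseries_interchange; last first.
  by move=> n j; rewrite mule_ge0// kernel_iter_ge0.
apply: eq_eseriesr => j _; rewrite muleC -ge0_nneseriesZl//.
  by apply: eq_eseriesr => n _; rewrite muleC.
by move=> n; exact: kernel_iter_ge0.
Qed.

(** Away from 0 the kernels [p] and [taboo 0] agree, so this is [nuE]. At 0 it follows by comparing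
    total masses, which are finite and preserved since [p] is stochastic. *)
Let nu_invariant k : kernel_push nu p k = nu k.
Proof.
have eq_off j : j != 0%N -> kernel_push nu p j = nu j.
  move=> j0; rewrite nuE /start (negbTE j0) add0e.
  by apply: eq_eseriesr => m _; rewrite /taboo (negbTE j0).
have [->|/eq_off//] := eqVneq k 0%N.
have : \sum_(j <oo) kernel_push nu p j = \sum_(j <oo) nu j.
  by rewrite kernel_push_mass//; apply: eq_eseriesr => j _; rewrite p_sum1 mule1.
move: nu_mass_lty.
rewrite [X in X < _](@nneseriesD1 _ _ 0%N)// [X in _ = X -> _](@nneseriesD1 _ _ 0%N)//.
rewrite [X in X = _ -> _](@nneseriesD1 _ _ 0%N)//; last first.
  by move=> j _; exact: kernel_push_ge0.
have -> : \sum_(j <oo | xpredT j && (j != 0%N)) kernel_push nu p j =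
    \sum_(j <oo | xpredT j && (j != 0%N)) nu j.
  by apply: eq_eseriesr => j; exact: eq_off.
set t := \sum_(_ <oo | _) _ => lt e.
have t0 : 0 <= t by apply: nneseries_ge0.
have ft : t \is a fin_num.
  by rewrite ge0_fin_numE//; apply: le_lt_trans lt; rewrite leeDr.
by rewrite -[LHS](addeK _ ft) e addeK.
Qed.

Lemma invariant_exists : exists q : nat -> R, [/\ forall i, (0 <= q i)%R,
  forall i, (q i)%:E = kernel_push (EFin \o q) p i & \sum_(i <oo) (q i)%:E = 1].
Proof.
have nuf k : nu k \is a fin_num.
  rewrite ge0_fin_numE//; apply: le_lt_trans nu_mass_lty.
  rewrite (@nneseriesD1 _ _ k)// leeDl// nneseries_ge0//.
set m := fine (\sum_(k <oo) nu k).
have mE : m%:E = \sum_(k <oo) nu k.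
  by rewrite fineK// ge0_fin_numE// nneseries_ge0.
have m_gt0 : (0 < m)%R.
  (* The excursion starts at 0, so [nu 0] is at least 1. *)
  rewrite -lte_fin mE (@nneseriesD1 _ _ 0%N)// nuE /start eqxx.
  rewrite (@lt_le_trans _ _ 1)// -addeA leeDl//.
  by apply: adde_ge0; [exact: kernel_push_ge0|exact: nneseries_ge0].
exists (fun k => m^-1 * fine (nu k))%R.
have qE k : (m^-1 * fine (nu k))%:E = m^-1%:E * nu k by rewrite EFinM fineK.
have mV0 : 0 <= m^-1%:E by rewrite lee_fin invr_ge0 ltW.
split => [k|k|].
- by rewrite -lee_fin qE mule_ge0.
- rewrite qE -nu_invariant -ge0_nneseriesZl//; last by move=> j; exact: mule_ge0.
  by apply: eq_eseriesr => j _; rewrite muleA -qE.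
- under eq_eseriesr do rewrite qE.
  by rewrite ge0_nneseriesZl// -mE -EFinM mulVf// gt_eqF.
Qed.

End Foster.

(** * Uniqueness of the invariant distribution *)

Section Uniqueness.
Context {R : realType}.
Variable p : nat -> nat -> \bar R.
Hypotheses (p_gt0 : forall i j, 0 < p i j)
  (p_sum1 : forall i, \sum_(j <oo) p i j = 1).

Let p_ge0 i j : 0 <= p i j. Proof. exact: ltW. Qed.

(* The excess of [q] over [min q q'] is itself invariant, so by positivity of
   [p] it vanishes everywhere or nowhere. *)
Let excess_gt0 (q q' : nat -> R) : (forall i, (0 <= q i)%R) ->
  (forall i, (0 <= q' i)%R) ->
  (forall i, (q i)%:E = kernel_push (EFin \o q) p i) ->
  (forall i, (q' i)%:E = kernel_push (EFin \o q') p i) ->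
  \sum_(i <oo) (q i)%:E < +oo ->
  forall j k, (q' j < q j)%R -> (q' k < q k)%R.
Proof.
move=> q0 q'0 qp q'p sq j k qj.
pose r i := Num.min (q i) (q' i); pose a i := (q i - r i)%R.
have r0 i : (0 <= r i)%R by rewrite le_min q0 q'0.
have a0 i : (0 <= a i)%R by rewrite subr_ge0 ge_min lexx.
have pr0 i : 0 <= kernel_push (EFin \o r) p i.
  by apply: kernel_push_ge0 => // l; rewrite /= lee_fin.
have pa0 i : 0 <= kernel_push (EFin \o a) p i.
  by apply: kernel_push_ge0 => // l; rewrite /= lee_fin.
(* Pushing is monotone and [r] lies below both [q] and [q'], so [r] can only decrease; as
   [q = r + a] is preserved, [a] can only increase. *)
have rp i : kernel_push (EFin \o r) p i <= (r i)%:E.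
  rewrite /r EFin_min le_min qp q'p; apply/andP; split.
  - apply: lee_nneseries => [l _ _|l _]; first by rewrite mule_ge0//; exact: r0.
    by rewrite lee_wpmul2r// lee_fin ge_min lexx.
  - apply: lee_nneseries => [l _ _|l _]; first by rewrite mule_ge0//; exact: r0.
    by rewrite lee_wpmul2r// lee_fin ge_min lexx orbT.
have split_q i : (q i)%:E = kernel_push (EFin \o r) p i + kernel_push (EFin \o a) p i.
  rewrite qp -nneseriesD//; last 2 first.
  - by move=> l _ _; rewrite mule_ge0 ?lee_fin.
  - by move=> l _ _; rewrite mule_ge0 ?lee_fin.
  apply: eq_eseriesr => l _; rewrite -ge0_muleDl ?lee_fin//= -EFinD.
  by rewrite /a addrC subrK.
have ap i : (a i)%:E <= kernel_push (EFin \o a) p i.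
  rewrite /a EFinB split_q leeBlDr//; last first.
  by rewrite addeC leeD2l.
(* A stochastic kernel preserves the finite total mass of [a], so the increase is an equality. *)
have apE : (EFin \o a) =1 kernel_push (EFin \o a) p.
  apply: eq_nneseries_sum_le.
  - by move=> i; rewrite ap /= lee_fin a0.
  - rewrite kernel_push_mass//.
    by apply: eq_eseriesr => l _; rewrite p_sum1 mule1.
  - apply: le_lt_trans sq; apply: lee_nneseries => [l _ _|l _]; rewrite lee_fin//.
    by rewrite /a gerBl.
have : (0 < a k)%R.
  rewrite -lte_fin -[(a k)%:E]/((EFin \o a) k) apE /kernel_push.
  rewrite (@nneseriesD1 _ _ j)//; last by move=> l _; rewrite mule_ge0 ?lee_fin.
  apply: (@lt_le_trans _ _ ((a j)%:E * p j k)).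
    by rewrite mule_gt0// lte_fin subr_gt0 gt_min qj orbT.
  by rewrite leeDl// nneseries_ge0// => l _ _; rewrite mule_ge0 ?lee_fin.
by rewrite subr_gt0 gt_min ltxx.
Qed.

(** A strict inequality at one state would spread to all states by [excess_gt0], contradicting the
    equal total masses. *)
Lemma invariant_unique (q q' : nat -> R) : (forall i, (0 <= q i)%R) ->
  (forall i, (0 <= q' i)%R) ->
  (forall i, (q i)%:E = kernel_push (EFin \o q) p i) ->
  (forall i, (q' i)%:E = kernel_push (EFin \o q') p i) ->
  \sum_(i <oo) (q i)%:E = 1 -> \sum_(i <oo) (q' i)%:E = 1 -> q =1 q'.
Proof.
have le (u u' : nat -> R) : (forall i, (0 <= u i)%R) -> (forall i, (0 <= u' i)%R) ->
    (forall i, (u i)%:E = kernel_push (EFin \o u) p i) ->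
    (forall i, (u' i)%:E = kernel_push (EFin \o u') p i) ->
    \sum_(i <oo) (u i)%:E = 1 -> \sum_(i <oo) (u' i)%:E = 1 ->
    forall j, (u j <= u' j)%R.
  move=> u0 u'0 up u'p su su' j; rewrite leNgt; apply/negP => uj.
  have gt k : (u' k < u k)%R.
    by apply: (excess_gt0 u0 u'0 up u'p) uj; rewrite su ltry.
  have : (EFin \o u') =1 (EFin \o u).
    apply: eq_nneseries_sum_le; last by rewrite su' ltry.
      by move=> i; rewrite /= !lee_fin u'0 ltW.
    by rewrite su su'.
  by move=> /(_ j)[e]; move: uj; rewrite e ltxx.
move=> q0 q'0 qp q'p sq sq' j; apply/eqP; rewrite eq_le.
by apply/andP; split; exact: le.
Qed.

End Uniqueness.

(** * Return times *)

Section Probability.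
Context d (T : measurableType d) (R : realType) (P : probability T R).

Lemma probability_setI_almost_sure (A B : set T) : measurable A -> measurable B ->
  P B = 1 -> P (A `&` B) = P A.
Proof.
move=> mA mB PB; have AC0 : P (A `\` B) = 0.
  apply/eqP; rewrite eq_le measure_ge0 andbT.
  apply: (@le_trans _ _ (P (~` B))).
    apply: le_measure; last by move=> x [].
      by rewrite inE; exact: measurableD.
    by rewrite inE; exact: measurableC.
  by rewrite probability_setC// PB subee.
by rewrite [RHS](measureDI P mA mB) [X in _ = X + _]AC0 add0e.
Qed.

End Probability.

Section Recurrence.
Context d (T : measurableType d) (R : realType).
Variables (p : nat -> nat -> \bar R) (Pr : nat -> probability T R)
  (K : nat -> {mfun T >-> nat}).
Hypotheses (p_ge0 : forall i j, 0 <= p i j) (K_chain : is_markov_chain p Pr K).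

(* The states 1, 2, 3, ... renumbered from 0. *)
Definition shift_kernel i j := p i.+1 j.+1.

Lemma measurable_cylinder (B : nat -> set nat) :
  measurable [set w | forall l, B l (K l w)].
Proof.
rewrite (_ : mkset _ = \bigcap_l (K l @^-1` B l)); last first.
  by apply/seteqP; split => w Bw l => [_|]; exact: Bw.
apply: bigcapT_measurable => l.
by rewrite -[X in measurable X]setTI; exact: (measurable_funP (K l)).
Qed.

(** The constraints are stated time by time, so that [measurable_cylinder] applies. *)
Let avoid (i : nat) (x : nat -> nat) n m := [set w | forall l,
  ((l <= n)%N -> K l w = x l) /\ ((n < l <= n + m)%N -> K l w <> i)].

Let path (x : nat -> nat) n := [set w | forall l, (l <= n)%N -> K l w = x l].

Let measurable_avoid i x n m : measurable (avoid i x n m).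
Proof.
exact: (@measurable_cylinder (fun l => [set k |
  ((l <= n)%N -> k = x l) /\ ((n < l <= n + m)%N -> k <> i)])).
Qed.

Let measurable_path x n : measurable (path x n).
Proof. exact: (@measurable_cylinder (fun l => [set k | (l <= n)%N -> k = x l])). Qed.

(** Induction on [m] with the prescribed path arbitrary: split by the value of the chain at time
    [n.+1] and apply the one-step Markov property. An upper bound suffices, so subadditivity
    replaces a disjoint decomposition. *)
Lemma avoid_le_survival s i n m (x : nat -> nat) : (0 < s)%N ->
  (forall l, (0 < x l)%N) ->
  Pr s (avoid i.+1 x n m) <=
  Pr s (path x n) * kernel_survival (taboo shift_kernel i) m (x n).-1.
Proof.
move=> s0; have [K0 /(_ s s0)[_ step]] := K_chain.
have tge0 j k : 0 <= taboo shift_kernel i j k by rewrite /taboo; case: ifP => // _; exact: p_ge0.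
elim: m n x => [|m ih] n x x0.
  by rewrite mule1 le_measure ?inE// => w aw l; case: (aw l).
(* The path [x] prolonged by the state with index [j], that is [j.+1]. *)
pose x' j l := if l == n.+1 then j.+1 else x l.
have x'E j l : (l <= n)%N -> x' j l = x l.
  by move=> ln; rewrite /x' ltn_eqF.
(* The forbidden index gives the empty event, matching the erased entry of [taboo]. *)
pose F j := if j == i then set0 else avoid i.+1 (x' j) n.+1 m.
have mF j : measurable (F j) by rewrite /F; case: ifP.
have -> : avoid i.+1 x n m.+1 = \bigcup_j F j.
  apply/seteqP; split => [w aw|w [j _]].
    have [_] := aw n.+1; rewrite ltnSn addnS ltnS leq_addr => /(_ isT) Ki.
    exists (K n.+1 w).-1 => //; rewrite /F ifF; last first.
      by apply/negbTE/eqP => e; apply: Ki; rewrite -e prednK.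
    move=> l; split => [|/andP[nl lm]].
      rewrite leq_eqVlt => /predU1P[->|ln]; first by rewrite /x' eqxx prednK.
      by rewrite x'E//; apply: (aw l).1.
    by apply: (aw l).2; rewrite ltnW//= addnS -addSn.
  rewrite /F; case: ifPn => // ji aw l; split => [ln|/andP[nl lm]].
    by rewrite -(x'E j)//; apply: (aw l).1; exact: leqW.
  have [->|ln] := eqVneq l n.+1.
    rewrite (aw n.+1).1// /x' eqxx => -[e]; by rewrite e eqxx in ji.
  by apply: (aw l).2; rewrite ltn_neqAle eq_sym ln nl /= addSn -addnS.
have /le_trans : Pr s (\bigcup_j F j) <= \sum_(j <oo) Pr s (F j).
  apply: measure_sigma_subadditive => //.
  exact: bigcupT_measurable.
apply.
rewrite /= /kernel_act -ge0_nneseriesZl//; last first.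
  by move=> j; rewrite mule_ge0// kernel_survival_ge0.
apply: lee_nneseries => // j _; rewrite /F /taboo.
case: ifPn => [_|ji]; first by rewrite measure0 mul0e mule0.
have x'0 l : (0 < x' j l)%N by rewrite /x'; case: ifP.
apply: le_trans (ih _ _ x'0) _.
have -> : Pr s (path (x' j) n.+1) = Pr s (path x n) * p (x n) j.+1.
  rewrite step// x'E// {2}/x' eqxx; congr (Pr s _ * _).
  by apply/seteqP; split => w aw l ln; have := aw l ln; rewrite x'E.
have -> : (x' j n.+1).-1 = j by rewrite /x' eqxx.
by rewrite muleA /shift_kernel prednK.
Qed.

Let survive i m := [set w | forall l, (0 < l <= m)%N -> K l w <> i].

Let measurable_survive i m : measurable (survive i m).
Proof.
exact: (@measurable_cylinder (fun l => [set k | (0 < l <= m)%N -> k <> i])).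
Qed.

(** The case of a path of length 0: intersecting with the almost sure event that the chain starts at
    [i.+1] does not change the probability. *)
Lemma survive_le i m : Pr i.+1 (survive i.+1 m) <=
  kernel_survival (taboo shift_kernel i) m i.
Proof.
have [K0 /(_ i.+1 (ltn0Sn _))[start _]] := K_chain.
have sE : [set w | K 0%N w = i.+1] = path (fun=> i.+1) 0.
  apply/seteqP; split => [w e l|w]; first by rewrite leqn0 => /eqP ->.
  by apply.
have path1 : Pr i.+1 (path (fun=> i.+1) 0) = 1 by rewrite -sE.
rewrite -(@probability_setI_almost_sure _ _ _ _ _ (path (fun=> i.+1) 0))//.
have := @avoid_le_survival i.+1 i 0 m (fun=> i.+1) (ltn0Sn _) (fun=> ltn0Sn _).
rewrite path1 mul1e /=; congr (Pr _ _ <= _).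
apply/seteqP; split => w => [aw|[a b] l].
  by split => l ?; [apply: (aw l).2|apply: (aw l).1].
by split => ?; [exact: b|exact: a].
Qed.

(** Tail-sum formula: [survive i m] is the event that the return time exceeds [m]. Without a return,
    all indicators are 1 and the infimum is over the empty set. *)
Lemma return_time_series i w :
  return_time R K i w = \sum_(m <oo) (\1_(survive i m) w)%:E.
Proof.
have [hit|nohit] := pselect (exists n, (0 < n)%N && (K n w == i)).
  have [n /andP[n0 /eqP Kn] nmin] := ex_minnP hit.
  transitivity (n%:R%:E : \bar R).
    apply/eqP; rewrite eq_le; apply/andP; split.
      by apply: ereal_inf_lbound; exists n.
    apply/ereal_infP => _ [m [m0 Km] <-].
    by rewrite lee_fin ler_nat nmin// m0 Km eqxx.
  rewrite (nneseries_split 0 n); last by move=> m _; rewrite lee_fin.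
  rewrite [X in _ + X]eseries0 ?adde0; last first.
    move=> m; rewrite add0n => nm _; rewrite indicE memNset//.
    by move=> /(_ n); rewrite n0 nm => /(_ isT).
  rewrite add0n (eq_big_nat _ _ (F2 := fun=> 1%:E)); last first.
    move=> m /andP[_ mn]; rewrite indicE mem_set// => l /andP[l0 lm] Kl.
    by have := nmin l; rewrite l0 Kl eqxx leqNgt (leq_ltn_trans lm mn) => /(_ isT).
  by rewrite sumEFin big_const_nat subn0 iter_addr_0.
have -> : return_time R K i w = +oo.
  rewrite /return_time (_ : image _ _ = set0) ?ereal_inf0//.
  apply/seteqP; split => // x [n [n0 Kn] _]; apply: nohit.
  by exists n; rewrite n0 Kn eqxx.
apply/esym/eqyP => A A0.
apply: le_trans (@nneseries_lim_ge _ _ xpredT 0 (Num.truncn A).+1 _); last first.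
  by move=> m _ _; rewrite lee_fin.
rewrite (eq_big_nat _ _ (F2 := fun=> 1%:E)); last first.
  move=> m _; rewrite indicE mem_set// => l /andP[l0 _] Kl.
  by apply: nohit; exists l; rewrite l0 Kl eqxx.
rewrite sumEFin big_const_nat subn0 iter_addr_0 lee_fin ltW//.
exact: truncnS_gt.
Qed.

(** Integrating the tail-sum formula term by term bounds the mean return time; a variable with
    finite mean is almost surely finite. *)
Lemma positive_recurrent_of_survival :
  (forall i, \sum_(m <oo) kernel_survival (taboo shift_kernel i) m i < +oo) ->
  positive_recurrent Pr K.
Proof.
move=> surv [//|i] _.
have mind m : measurable_fun setT (EFin \o \1_(survive i.+1 m) : T -> \bar R).
  by apply/measurable_EFinP; exact: measurable_indic.
have ind0 m w : 0 <= (\1_(survive i.+1 m) w)%:E :> \bar R by rewrite lee_fin.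
have rE : return_time R K i.+1 = fun w => \sum_(m <oo) (\1_(survive i.+1 m) w)%:E.
  by apply/funext => w; exact: return_time_series.
have mr : measurable_fun setT (return_time R K i.+1 : T -> \bar R).
  by rewrite rE; apply: ge0_emeasurable_sum => [m w _ _|m _]; [exact: ind0|exact: mind].
have r0 w : 0 <= (return_time R K i.+1 w : \bar R) by rewrite rE nneseries_ge0.
have rlty : \int[Pr i.+1]_w return_time R K i.+1 w < +oo.
  rewrite rE integral_nneseries//.
  apply: le_lt_trans (surv i); apply: lee_nneseries => m _.
    move=> _; exact: integral_ge0.
  by rewrite integral_indic// setIT; exact: survive_le.
split => //.
have ir : (Pr i.+1).-integrable setT (return_time R K i.+1 : T -> \bar R).
  apply/integrableP; split => //.
  by under eq_integral do rewrite gee0_abs//.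
have mfin : measurable [set w | return_time R K i.+1 w < +oo :> \bar R].
  by rewrite -[X in measurable X]setTI; exact: emeasurable_fun_infty_o.
have Z : Pr i.+1 (~` [set w | return_time R K i.+1 w < +oo :> \bar R]) = 0.
  apply/negligibleP; first exact: measurableC.
  apply: negligibleS (integrable_ae measurableT ir) => w /= nlt fin; apply: nlt.
  by rewrite -ge0_fin_numE// fin.
have := probability_setC (Pr i.+1) (measurableC mfin).
by rewrite setCK Z sube0.
Qed.

End Recurrence.

(** * Stage transition probabilities *)

Section EventProbabilities.
Context d (T : measurableType d) (R : realType) (P : probability T R).

Lemma positive_measure_cover (A : set T) (F : nat -> set T) : 0 < P A ->
  measurable A -> (forall n, measurable (F n)) -> A `<=` \bigcup_n F n ->
  exists n, 0 < P (F n).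
Proof.
move=> PA mA mF AF; apply: contrapT => /forallNP F0; move: PA; apply/negP.
rewrite -leNgt (le_trans (measure_sigma_subadditive P mF mA AF))// eseries0//.
by move=> n _ _; apply/eqP; rewrite eq_le measure_ge0 andbT leNgt; exact/negP/F0.
Qed.

Lemma measurable_rv_lt (X Y : T -> R) : measurable_fun setT X ->
  measurable_fun setT Y -> measurable [set w | (X w < Y w)%R].
Proof.
move=> mX mY; rewrite -[X in measurable X]setTI.
by have := measurable_fun_ltr mX mY; move=> /(_ measurableT [set true]); exact.
Qed.

Lemma measurable_rv_preimage (X : {RV P >-> R}) (A : set R) : measurable A ->
  measurable (X @^-1` A).
Proof. by move=> mA; rewrite -[X in measurable X]setTI; exact: measurable_funP. Qed.

Lemma probability_almost_surely (A : nat -> set T) :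
  (forall n, measurable (A n)) -> (forall n, P (A n) = 1) ->
  P (\bigcap_n A n) = 1.
Proof.
move=> mA PA; rewrite -[\bigcap_n A n]setCK.
have mC : measurable (~` \bigcap_n A n) by apply: measurableC; exact: bigcapT_measurable.
rewrite probability_setC// (_ : P _ = 0) ?sube0//.
apply/eqP; rewrite eq_le measure_ge0 andbT setC_bigcap.
have mAC n : measurable (~` A n) by exact: measurableC.
have := measure_sigma_subadditive P mAC (bigcupT_measurable _ mAC) (@subset_refl _ _).
move=> /le_trans; apply.
by rewrite eseries0// => n _ _; transitivity (1 - P (A n)); [exact: probability_setC|rewrite PA subee].
Qed.

(** The complement of the event is split into [[0, x]], of known probability, and the negative
    half-line, which is null because the density vanishes there. *)
Lemma exponential_tail (mu x : R) (X : {RV P >-> R}) : (0 < mu)%R -> (0 < x)%R ->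
  exponential_law mu X -> P [set w | (x < X w)%R] = (expR (- mu * x))%:E.
Proof.
move=> mu0 x0 lawX.
have neg0 : P (X @^-1` `]-oo, 0%R[) = 0.
  have := lawX `]-oo, 0%R[%classic (measurable_itv _).
  rewrite /distribution /pushforward => ->; apply: integral0_eq => y /=.
  rewrite in_itv/= => y0; rewrite /exponential_pdf patchE ifF//.
  by apply/negbTE; rewrite notin_setE /= in_itv /= andbT leNgt y0.
have pos : P (X @^-1` `[0%R, x]) = 1 - (expR (- mu * x))%:E.
  have := lawX `[0%R, x]%classic (measurable_itv _).
  by rewrite /distribution /pushforward => ->; rewrite exponential_prob_itv0c.
have -> : [set w | (x < X w)%R] = ~` (X @^-1` `[0%R, x] `|` X @^-1` `]-oo, 0%R[).
  apply/seteqP; split => w /=; rewrite !in_itv/=.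
    move=> xX []; first by rewrite [(_ <= x)%R]leNgt xX andbF.
    by rewrite ltNge ltW// (lt_trans x0).
  by move=> /not_orP[/negP]; rewrite negb_and -!ltNge => /orP[h []|].
have m1 : measurable (X @^-1` `[0%R, x]) by exact: measurable_rv_preimage.
have m2 : measurable (X @^-1` `]-oo, 0%R[) by exact: measurable_rv_preimage.
rewrite probability_setC ?measureU0//; last exact: measurableU.
rewrite [X in 1 - X]pos -[LHS]/((1 - (1 - expR (- mu * x)))%:E).
by rewrite opprB addrC subrK.
Qed.

Lemma exponential_gt0 (mu : R) (X : {RV P >-> R}) : (0 < mu)%R ->
  exponential_law mu X -> P [set w | (0 < X w)%R] = 1.
Proof.
move=> mu0 lawX.
have m0 : measurable [set w | (0 < X w)%R] by exact: measurable_rv_lt.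
apply/eqP; rewrite eq_le probability_le1//=.
apply/lee_addgt0Pr => e e0.
(* The level [e / mu] has tail [expR (- e)], which is at least [1 - e]. *)
apply: (@le_trans _ _ ((expR (- mu * (e / mu)))%:E + e%:E)).
  rewrite -EFinD lee_fin mulNr mulrCA mulfV ?gt_eqF// mulr1.
  by have := expR_ge1Dx (- e); lra.
rewrite leeD2r// -(@exponential_tail _ _ X)// ?divr_gt0//.
apply: le_measure; rewrite ?inE//; first exact: measurable_rv_lt.
by move=> w /=; apply: lt_trans; rewrite divr_gt0.
Qed.

Lemma exponential_interval_gt0 (mu l u : R) (X : {RV P >-> R}) : (0 < mu)%R ->
  exponential_law mu X -> (0 <= l < u)%R -> 0 < P (X @^-1` `]l, u]).
Proof.
(* [exponential_tail] needs a positive level and [l] may be 0, so the midpoint [m] replaces [l]; the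
   tails at [m] and [u] differ strictly. *)
move=> mu0 lawX /andP[l0 lu]; pose m := ((l + u) / 2)%R.
have [lm mu' m0] : [/\ (l < m)%R, (m < u)%R & (0 < m)%R] by rewrite /m; split; lra.
have u0 : (0 < u)%R by lra.
have mlt c : measurable [set w | (c < X w)%R] by exact: measurable_rv_lt.
have mX := @measurable_rv_preimage X.
apply: (@lt_le_trans _ _ (P (X @^-1` `]m, u]))); last first.
  apply: le_measure; rewrite ?inE; [exact: mX|exact: mX|move=> w /=].
  by rewrite !in_itv/= => /andP[/(lt_trans lm) -> ->].
have : P [set w | (m < X w)%R] <= P (X @^-1` `]m, u]) + P [set w | (u < X w)%R].
  apply: le_trans (measureU2 _ (mX _ (measurable_itv _)) (mlt u)).
  apply: le_measure; rewrite ?inE//.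
    by apply: measurableU => //; exact: mX.
  move=> w /= mw; have [uw|uw] := ltP u (X w); first by right.
  by left; rewrite /= in_itv/= mw uw.
rewrite !(exponential_tail mu0 _ lawX)// => le.
rewrite lt0e measure_ge0 andbT; apply/eqP => P0; move: le; rewrite P0 add0e lee_fin.
by rewrite ler_expR leNgt ltr_nM2l ?oppr_lt0// mu'.
Qed.

End EventProbabilities.

(** * Total mass and mean of a law given by its tails *)

Section TelescopingSeries.
Context {R : realType}.
Variables (g : nat -> R) (c phi : R).
Hypotheses (phi01 : (0 <= phi < 1)%R) (g_ge0 : forall n, (0 <= g n)%R)
  (g_noninc : forall n, (g n.+1 <= g n)%R)
  (g_geom : forall n, (g n <= c * phi ^+ n)%R).

Lemma telescoping_series : \sum_(j <oo) (g j - g j.+1)%:E = (g 0%N)%:E.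
Proof.
have g0 : g n @[n --> \oo] --> (0 : R)%R.
  apply: (@squeeze_cvgr _ _ _ _ (cst 0%R) (geometric c phi)).
  - by apply: nearW => n; rewrite g_ge0/= g_geom.
  - exact: cvg_cst.
  - by apply: cvg_geometric; rewrite ger0_norm; case/andP: phi01.
have lim : (g 0%N - g n)%R @[n --> \oo] --> (g 0%N - 0)%R.
  by apply: cvgB => //; exact: cvg_cst.
rewrite (_ : (fun n => \sum_(0 <= j < n) _) = EFin \o (fun n => g 0%N - g n)%R).
  by rewrite EFin_lim; [rewrite (cvg_lim _ lim)// subr0|exact: cvgP lim].
apply/funext => n /=; rewrite sumEFin; congr EFin.
elim: n => [|n ih]; first by rewrite big_geq// subrr.
by rewrite big_nat_recr//= ih; ring.
Qed.

(** After summation by parts the mean is a sum of tails: the first [J] are bounded by 1, the others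
    by a geometric series with sum at most [c / 2]. *)
Lemma telescoping_first_moment J : (g 0%N <= 1)%R ->
  (phi ^+ J <= (1 - phi) / 2)%R -> (0 <= c)%R ->
  \sum_(j <oo) (g j - g j.+1)%:E * (j.+1%:R)%:E <= (J%:R + c / 2)%:E.
Proof.
move=> g01 phiJ c0; have /andP[p0 p1] := phi01.
have gle1 n : (g n <= 1)%R by elim: n => // n; exact: le_trans (g_noninc n).
have step0 j : 0 <= (g j - g j.+1)%:E * (j.+1%:R)%:E.
  by rewrite -EFinM lee_fin mulr_ge0// subr_ge0.
apply: lime_le; first by apply: is_cvg_nneseries => j _ _; exact: step0.
apply: nearW => n.
have -> : \sum_(0 <= j < n) (g j - g j.+1)%:E * (j.+1%:R)%:E =
    (\sum_(j < n) g j - n%:R * g n)%:E.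
  elim: n => [|n ih]; first by rewrite big_geq// big_ord0 mul0r subrr.
  rewrite big_nat_recr//= ih -EFinM -EFinD big_ord_recr/= -!natr1.
  by congr EFin; ring.
rewrite lee_fin lerBlDr.
apply: (@le_trans _ _ (J%:R + c / 2)%R); last by rewrite lerDl mulr_ge0.
(* Summing up to [J + n] instead of [n] avoids the case [n < J]. *)
apply: (@le_trans _ _ (\sum_(j < J + n) g j)%R).
  rewrite addnC big_split_ord/= lerDl; exact: sumr_ge0.
have : (\sum_(j < J + n) g j <= J%:R + c * (phi ^+ J - phi ^+ (J + n)) / (1 - phi))%R.
  elim: n => [|n ih].
    rewrite addn0 subrr mulr0 mul0r addr0 -[leRHS]mulr_natl.
    rewrite mulr1 -[X in (_ <= X%:R)%R]card_ord -sumr_const.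
    exact: ler_sum.
  rewrite addnS big_ord_recr/=; apply: le_trans (lerD ih (g_geom _)) _.
  rewrite exprS -subr_ge0 [leRHS](_ : _ = 0%R)//; field.
  by rewrite gt_eqF// subr_gt0.
move=> /le_trans; apply; rewrite lerD2l ler_pdivrMr ?subr_gt0// -mulrA ler_wpM2l//.
by have := exprn_ge0 (J + n) p0; lra.
Qed.

End TelescopingSeries.

(** * Arrival epochs against service times *)

Section StageTransition.
Context (R : realType) d (T : measurableType d) (P : probability T R).
Variables (tau sigma : nat -> {RV P >-> R}) (mu : R).
Hypotheses (mu_gt0 : (0 < mu)%R)
  (indep : mutually_independent
     (fun k : nat + nat => match k with inl m => tau m | inr m => sigma m end))
  (tau_same_law : forall m, same_law (tau m) (tau 0%N))
  (tau_gt0 : forall m, P [set w | (0 < tau m w)%R] = 1)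
  (sigma_exp : forall m, exponential_law mu (sigma m)).

Let tauE m (A : set R) : measurable A -> P (tau m @^-1` A) = P (tau 0%N @^-1` A).
Proof. exact: tau_same_law. Qed.

Let measurable_product_event n i (A B : nat -> set R) :
  (forall k, measurable (A k)) -> (forall k, measurable (B k)) ->
  measurable [set w | (forall k, (k < n)%N -> A k (tau k w)) /\
                      (forall k, (k < i)%N -> B k (sigma k w))].
Proof.
move=> mA mB.
rewrite (_ : [set _ | _] = (\bigcap_(k in `I_n) (tau k @^-1` A k)) `&`
    (\bigcap_(k in `I_i) (sigma k @^-1` B k))).
  by apply: measurableI; apply: bigcap_measurableType => k _;
    exact: measurable_rv_preimage.
apply/seteqP; split => w [h1 h2]; split => k kn.
- exact: h1.
- exact: h2.
- exact: h1.
- exact: h2.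
Qed.

Lemma independent_events n i (A B : nat -> set R) : (forall k, measurable (A k)) ->
  (forall k, measurable (B k)) ->
  P [set w | (forall k, (k < n)%N -> A k (tau k w)) /\
             (forall k, (k < i)%N -> B k (sigma k w))] =
  \prod_(k < n) P (tau k @^-1` A k) * \prod_(k < i) P (sigma k @^-1` B k).
Proof.
move=> mA mB.
(* The tags [inl] and [inr] make the two families of indices disjoint, so one product rule covers
   both. *)
pose J : seq (nat + nat) := [seq inl k | k <- iota 0 n] ++ [seq inr k | k <- iota 0 i].
have := indep (J := J) (B := fun k => match k with inl k => A k | inr k => B k end).
have uJ : uniq J.
  rewrite cat_uniq !map_inj_uniq ?iota_uniq; [|by move=> ? ? []|by move=> ? ? []].
  by rewrite andbT; apply/hasPn => _ /mapP[k _ ->]; apply/negP => /mapP[].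
move=> /(_ uJ); rewrite big_cat/= !big_map -(big_mkord xpredT (fun k => P (tau k @^-1` A k))).
rewrite -(big_mkord xpredT (fun k => P (sigma k @^-1` B k))).
rewrite /index_iota !subn0 => <-; last by case.
congr (P _); apply/seteqP; split => [w [Aw Bw] k|w h].
  rewrite /= mem_cat => /orP[] /mapP[l]; rewrite mem_iota add0n => /andP[_ ln] ->.
    exact: Aw.
  exact: Bw.
split=> k kn.
  by apply: (h (inl k)); rewrite /= mem_cat map_f ?mem_iota.
by apply: (h (inr k)); rewrite /= mem_cat orbC map_f ?mem_iota.
Qed.

Let tau0_measurable : measurable [set w | (0 < tau 0%N w)%R].
Proof. exact: measurable_rv_lt. Qed.

(** The levels [n.+1%:R^-1] exhaust the event that [tau 0] is positive, so one of them is exceeded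
    with positive probability. *)
Let tau_threshold : exists2 a : R, (0 < a)%R & 0 < P [set w | (a < tau 0%N w)%R].
Proof.
have mF n : measurable [set w | (n.+1%:R^-1 < tau 0%N w)%R].
  exact: measurable_rv_lt.
have [||n Pn] := @positive_measure_cover _ _ _ P _ _ _ tau0_measurable mF.
- by rewrite tau_gt0.
- move=> w /= tw; exists (Num.truncn (tau 0%N w)^-1) => //=.
  rewrite invf_plt ?posrE// ?ltr0n//.
  exact: Num.Theory.truncnS_gt.
- by exists n.+1%:R^-1%R; rewrite ?invr_gt0 ?ltr0n.
Qed.

(** Cut the half-line beyond [a] into countably many intervals of length [eps]; one of them is
    charged. *)
Let tau_interval (a eps : R) : (0 < eps)%R -> 0 < P [set w | (a < tau 0%N w)%R] ->
  exists2 l : R, (a <= l)%R & 0 < P (tau 0%N @^-1` `]l, (l + eps)%R]).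
Proof.
move=> e0 Pa.
have mF n : measurable (tau 0%N @^-1` `](a + n%:R * eps)%R, (a + n%:R * eps + eps)%R]).
  exact: measurable_rv_preimage.
have ma : measurable [set w | (a < tau 0%N w)%R] by exact: measurable_rv_lt.
have [w /= aw|n Pn] := positive_measure_cover Pa ma mF; last first.
  by exists (a + n%:R * eps)%R => //; rewrite lerDl mulr_ge0// ltW.
pose y := ((tau 0%N w - a) / eps)%R.
have y0 : (0 < y)%R by rewrite divr_gt0// subr_gt0.
have tE : tau 0%N w = (a + y * eps)%R by rewrite mulfVK ?gt_eqF// addrC subrK.
(* [n] is the predecessor of the least integer not below [y], as the intervals are open on the
   left. *)
have [n /andP[ny yn]] : exists n : nat, (n%:R < y <= n.+1%:R)%R.
  have /ex_minnP[[|n] yn nmin] : exists n : nat, (y <= n%:R)%R.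
    by exists (Num.truncn y).+1; rewrite ltW// Num.Theory.truncnS_gt.
  - by move: yn; rewrite leNgt y0.
  - exists n; rewrite yn andbT ltNge; apply/negP => /nmin.
    by rewrite ltnn.
exists n => //=; rewrite in_itv/= tE; apply/andP; split.
  by rewrite ltrD2l ltr_pM2r.
by move: yn; rewrite -natr1 -(ler_pM2r e0) mulrDl mul1r; lra.
Qed.

(** * Geometric decay of the probability that a service outlasts [j] arrivals *)

Section GeometricBound.
Variables (a : R) (a_gt0 : (0 < a)%R).
Let b := fine (P [set w | (a < tau 0%N w)%R]).
(** Laplace transform at [mu] of the variable equal to [a] when [tau 0] exceeds [a] and to 0
    otherwise. *)
Let phi := ((1 - b) + b * expR (- mu * a))%R.

Let big_events m : measurable [set w | (a < tau m w)%R].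
Proof. exact: measurable_rv_lt. Qed.

Let bE m : P [set w | (a < tau m w)%R] = b%:E.
Proof.
have -> : P [set w | (a < tau m w)%R] = P [set w | (a < tau 0%N w)%R].
  have := @tauE m `]a, +oo[%classic (measurable_itv _).
  by congr (P _ = P _); apply/seteqP; split => w /=; rewrite in_itv/= andbT.
by rewrite fineK// fin_num_measure.
Qed.

Let bC m : P (tau m @^-1` `]-oo, a]) = (1 - b)%:E.
Proof.
have -> : tau m @^-1` `]-oo, a] = ~` [set w | (a < tau m w)%R].
  by apply/seteqP; split => w /=; rewrite in_itv/= leNgt => /negP.
by rewrite probability_setC// bE.
Qed.

Let b01 : (0 <= b <= 1)%R.
Proof. by rewrite -!lee_fin -(bE 0) measure_ge0 probability_le1. Qed.

(** The probability that the first indicators follow the pattern [s]. *)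
Let weight (s : seq bool) := (\prod_(x <- s) if x then b else 1 - b)%R.

(* Replacing [tau_k] by [a] or 0 according to [a < tau_k] and expanding over the
   patterns [s] of these indicators, P(S_j < sigma_m) is bounded by product rules
   for events only, with no recourse to joint laws. *)
Let pattern m s n := [set w |
  (forall k, (k < size s)%N -> (a < tau k w)%R = nth false s k) /\
  (a * (count id s + \sum_(size s <= k < size s + n) (a < tau k w)%R)%:R < sigma m w)%R].

Let pattern_step m s n :
  pattern m s n.+1 = pattern m (rcons s true) n `|` pattern m (rcons s false) n.
Proof.
have step x w : (a < tau (size s) w)%R = x ->
    pattern m s n.+1 w <-> pattern m (rcons s x) n w.
  move=> tx; rewrite /pattern /= size_rcons -cats1 count_cat /= addn0.
  rewrite big_ltn ?addnS ?ltnS ?leq_addr// tx addnA addSn.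
  split => -[h1 h2]; split => // k; last first.
    by move=> ks; have := h1 k (leqW ks); rewrite nth_cat ks.
  rewrite ltnS leq_eqVlt nth_cat => /predU1P[->|ks]; first by rewrite ltnn subnn.
  by rewrite ks h1.
apply/seteqP; split => w.
  by case tx : (a < tau (size s) w)%R => /(step _ _ tx); [left|right].
by case=> h; have := h.1 (size s);
  rewrite size_rcons ltnSn nth_rcons ltnn eqxx => /(_ isT) /step[_]; apply.
Qed.

(** Fixing one more indicator contributes [b * expR (- mu * a)] or [1 - b], which add up to [phi];
    once all are fixed, the event is a product event. *)
Let pattern_bound m n s : measurable (pattern m s n) /\
  P (pattern m s n) <= (weight s * expR (- mu * a * (count id s)%:R) * phi ^+ n)%:E.
Proof.
elim: n s => [|n ih] s; last first.
  have [m1 P1] := ih (rcons s true); have [m2 P2] := ih (rcons s false).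
  rewrite pattern_step; split; first exact: measurableU.
  apply: le_trans (measureU2 _ m1 m2) _.
  apply: le_trans (leeD P1 P2) _; rewrite -EFinD lee_fin.
  rewrite /weight -!cats1 !big_cat !big_seq1 !count_cat /= !addn0 addn1 -natr1.
  rewrite mulrDr mulr1 expRD exprS /phi.
  by rewrite -subr_ge0 [leRHS](_ : _ = 0%R)//; ring.
(* Once [s] is fixed the threshold for [sigma m] is a constant; the other service times are
   unconstrained. *)
pose A k := if nth false s k then `]a, +oo[%classic else `]-oo, a]%classic.
pose B k := if k == m then `](a * (count id s)%:R)%R, +oo[%classic else setT.
have mA k : measurable (A k) by rewrite /A; case: ifP => _; exact: measurable_itv.
have mB k : measurable (B k) by rewrite /B; case: ifP.
have pE : pattern m s 0 = [set w | (forall k, (k < size s)%N -> A k (tau k w)) /\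
             (forall k, (k < m.+1)%N -> B k (sigma k w))].
  apply/seteqP; split => w; rewrite /pattern /A /B /= addn0 big_geq// addn0.
    move=> [h1 h2]; split => k; last by case: eqP => //= -> _; rewrite in_itv/= h2.
    by move=> /h1 <-; case: ifPn => [ak|]; rewrite /= in_itv/= ?ak// -leNgt.
  move=> [h1 h2]; split => [k /h1|]; last first.
    by have := h2 m (ltnSn m); rewrite eqxx /= in_itv/= andbT.
  by case: ifP => _; rewrite /= in_itv/= ?andbT// leNgt => /negbTE.
split; first by rewrite pE; exact: measurable_product_event.
rewrite pE independent_events// expr0 mulr1 EFinM.
have -> : \prod_(k < size s) P (tau k @^-1` A k) = (weight s)%:E.
  rewrite -prodEFin (big_nth false) big_mkord; apply: eq_bigr => k _.
  rewrite /A; case: ifP => _; last exact: bC.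
  by rewrite -(bE k); congr (P _); apply/seteqP; split => w /=; rewrite in_itv/= andbT.
apply: lee_wpmul2l.
  rewrite lee_fin /weight prodr_ge0// => x _; case: ifP => _.
    by case/andP: b01.
  by rewrite subr_ge0; case/andP: b01.
rewrite big_ord_recr big1 => [|k _] /=; last first.
  by rewrite /B ltn_eqF// preimage_setT probability_setT.
(* With no large interarrival time the threshold is 0, where [exponential_tail] does not apply, but
   the bound is 1. *)
rewrite mul1e /B eqxx; have [c0|c0] := posnP (count id s).
  by rewrite c0 mulr0 mulr0 expR0; apply: probability_le1; exact: measurable_rv_preimage.
rewrite -mulrA -(@exponential_tail _ _ _ P _ _ (sigma m))//; last first.
  by rewrite mulr_gt0 ?ltr0n.
rewrite le_eqVlt; apply/orP; left; apply/eqP.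
by congr (P _); apply/seteqP; split => w /=; rewrite in_itv/= andbT.
Qed.

(** The bound for the empty pattern: on the almost sure event that all interarrival times are
    positive, the epoch is at least [a] times the number of those exceeding [a]. *)
Lemma arrival_epoch_lt_service j m :
  P [set w | (arrival_epoch tau j w < sigma m w)%R] <= (phi ^+ j)%:E.
Proof.
have [mp Pp] := pattern_bound m j [::].
have mtau k : measurable [set w | (0 < tau k w)%R] by exact: measurable_rv_lt.
have mG : measurable (\bigcap_k [set w | (0 < tau k w)%R]) by exact: bigcapT_measurable.
have mS : measurable [set w | (arrival_epoch tau j w < sigma m w)%R].
  by apply: measurable_rv_lt => //; exact: measurable_sum.
have PG : P (\bigcap_k [set w | (0 < tau k w)%R]) = 1.
  exact: probability_almost_surely.
rewrite -(probability_setI_almost_sure mS mG PG).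
have : P (pattern m [::] j) <= (phi ^+ j)%:E.
  by apply: le_trans Pp _; rewrite /weight big_nil /= mulr0 expR0 !mul1r.
apply: le_trans; apply: le_measure; rewrite ?inE//; first exact: measurableI.
move=> w [/= Sw Gw]; split => //=; apply: le_lt_trans Sw.
rewrite add0n big_mkord natr_sum mulr_sumr; apply: ler_sum => k _.
case: ltP => [/ltW|_]; first by rewrite mulr1.
by rewrite mulr0 ltW//; exact: Gw.
Qed.

Lemma geometric_ratio_bounds : 0 < P [set w | (a < tau 0%N w)%R] -> (0 <= phi < 1)%R.
Proof.
rewrite bE lte_fin => b0; have /andP[_ b1] := b01; have e0 := expR_gt0 (- mu * a).
have e1 : (expR (- mu * a) < 1)%R by rewrite expR_lt1 mulNr oppr_lt0 mulr_gt0.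
by rewrite /phi; apply/andP; split; nra.
Qed.

End GeometricBound.

(** Indices are shifted as in [shift_kernel]: [i] stands for a stage with [i.+1] customers. *)
Let gap i j := [set w | (arrival_epoch tau j w < stage_duration sigma i.+1 w)%R].
Let g i j := fine (P (gap i j)).

Lemma lt_stage_duration i x w : (x < stage_duration sigma i.+1 w)%R <->
  exists2 k, (k < i.+1)%N & (x < sigma k w)%R.
Proof.
split=> [/bigmax_gtP[x0|[k _ xk]]|[k ki xk]]; [by exists 0%N|by exists k|].
by apply/bigmax_gtP; right; exists (Ordinal ki).
Qed.

Lemma measurable_stage_duration i : measurable_fun setT (stage_duration sigma i).
Proof.
rewrite /stage_duration; elim: (index_enum _) => [|k r ih].
  by under eq_fun do rewrite big_nil; exact: measurable_funP.
under eq_fun do rewrite big_cons.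
by apply: measurable_maxr => //; exact: measurable_funP.
Qed.

Lemma measurable_arrival_epoch j : measurable_fun setT (arrival_epoch tau j).
Proof. exact: measurable_sum. Qed.

Let measurable_gap i j : measurable (gap i j).
Proof.
by apply: measurable_rv_lt; [exact: measurable_arrival_epoch|exact: measurable_stage_duration].
Qed.

Let gE i j : P (gap i j) = (g i j)%:E.
Proof. by rewrite fineK// fin_num_measure. Qed.

Let g_ge0 i j : (0 <= g i j)%R. Proof. by rewrite -lee_fin -gE. Qed.

Let g0 i : g i 0 = 1%R.
Proof.
apply: EFin_inj; rewrite -gE; apply/eqP; rewrite eq_le probability_le1//=.
rewrite -(exponential_gt0 mu_gt0 (sigma_exp 0)).
apply: le_measure; rewrite ?inE//; first exact: measurable_rv_lt.
move=> w /= s0; rewrite /gap /= /arrival_epoch big_ord0.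
by apply/lt_stage_duration; exists 0%N.
Qed.

Let epoch_recr j w : arrival_epoch tau j.+1 w = (arrival_epoch tau j w + tau j w)%R.
Proof. by rewrite /arrival_epoch big_ord_recr. Qed.

(** The transition event is [gap i j] minus [gap i j.+1]. These are nested only where [tau j] is
    positive, which holds almost surely. *)
Lemma stage_transition_gap i j :
  stage_transition tau sigma i.+1 j.+1 = (g i j - g i j.+1)%:E.
Proof.
have mt : measurable [set w | (0 < tau j w)%R] by exact: measurable_rv_lt.
have : P (gap i j) = P (gap i j `\` gap i j.+1) + P (gap i j `&` gap i j.+1).
  exact: measureDI.
have -> : P (gap i j `&` gap i j.+1) = (g i j.+1)%:E.
  rewrite -gE -(probability_setI_almost_sure _ mt (tau_gt0 j)); last exact: measurableI.
  rewrite -[RHS](probability_setI_almost_sure _ mt (tau_gt0 j))//.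
  congr (P _); apply/seteqP; split => w [/=]; first by case.
  move=> Sw tw; split => //; split => //.
  by move: Sw; rewrite /gap /= epoch_recr; apply: lt_trans; rewrite ltrDl.
have -> : P (gap i j `\` gap i j.+1) = stage_transition tau sigma i.+1 j.+1.
  congr (P _); apply/seteqP; split => w /= [h1 h2]; split => //.
    by move: h2 => /negP; rewrite -leNgt.
  by apply/negP; rewrite -leNgt.
by rewrite gE EFinB => ->; rewrite addeK.
Qed.

Let g_noninc i j : (g i j.+1 <= g i j)%R.
Proof. by rewrite -subr_ge0 -lee_fin -stage_transition_gap measure_ge0. Qed.

(** Union bound over the [i.+1] service times, with a ratio that does not depend on [i]. *)
Let g_geometric : exists2 phi : R, (0 <= phi < 1)%R &
  forall i j, (g i j <= i.+1%:R * phi ^+ j)%R.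
Proof.
have [a a0 Pa] := tau_threshold.
eexists; first exact: geometric_ratio_bounds a0 Pa.
move=> i j; rewrite -lee_fin -gE.
have mS k : measurable [set w | (arrival_epoch tau j w < sigma k w)%R].
  by apply: measurable_rv_lt => //; exact: measurable_arrival_epoch.
have := Boole_inequality P (n := i.+1) (fun k _ => mS k).
move=> H; apply: (le_trans (le_trans _ H)).
  apply: le_measure; rewrite ?inE//; first exact: bigsetU_measurable.
  move=> w /lt_stage_duration[k ki xk].
  rewrite -(bigcup_mkord _ (fun k => [set w | (arrival_epoch tau j w < sigma k w)%R])).
  by exists k.
apply: (@le_trans _ _ (\sum_(k < i.+1) _)).
  by apply: lee_sum => k _; exact: arrival_epoch_lt_service a0 j k.
by rewrite sumEFin lee_fin sumr_const card_ord mulr_natl.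
Qed.

Lemma stage_transition_sum i : \sum_(j <oo) stage_transition tau sigma i.+1 j.+1 = 1.
Proof.
have [phi phi01 gphi] := g_geometric.
under eq_eseriesr do rewrite stage_transition_gap.
by rewrite (telescoping_series phi01 (g_ge0 i) (gphi i)) g0.
Qed.

(** [J] depends only on the geometric ratio, hence is uniform in [i]; the slope 1/2, being below 1,
    yields a negative drift for large [i]. *)
Lemma stage_transition_drift : exists J : nat, forall i,
  \sum_(j <oo) stage_transition tau sigma i.+1 j.+1 * (j.+1%:R)%:E <=
  (J%:R + i.+1%:R / 2)%:E.
Proof.
have [phi phi01 gphi] := g_geometric; have /andP[p0 p1] := phi01.
have [J phiJ] : exists J, (phi ^+ J <= (1 - phi) / 2)%R.
  have : (phi ^+ n)%R @[n --> \oo] --> (0 : R)%R by apply: cvg_expr; rewrite ger0_norm.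
  move=> /cvgrPdist_le /(_ ((1 - phi) / 2)%R) [|J _ /(_ J (leqnn J))].
    by rewrite divr_gt0// subr_gt0.
  by rewrite /= sub0r normrN ger0_norm ?exprn_ge0//; exists J.
exists J => i; under eq_eseriesr do rewrite stage_transition_gap.
apply: (telescoping_first_moment phi01 (g_ge0 i) (g_noninc i) (gphi i)) => //.
by rewrite g0.
Qed.

(* With all [tau_k], [k <= j], in an interval ]l, l + eps] so short that
   [j * (l + eps) < (j + 1) * l], it suffices that the maximum of the service times
   falls between these two bounds. *)
Lemma stage_transition_gt0 i j : 0 < stage_transition tau sigma i.+1 j.+1.
Proof.
have [a a0 Pa] := tau_threshold.
(* This length gives [j * e < a <= l], hence [lo < hi]. *)
have e0 : (0 < a / j.+1%:R)%R by rewrite divr_gt0.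
have [l al Pl] := tau_interval e0 Pa; move: e0 Pl; set e := (a / _)%R => e0 Pl.
pose lo := (j%:R * (l + e))%R; pose hi := (j.+1%:R * l)%R.
have je : (j%:R * e < a)%R.
  by rewrite /e mulrCA -subr_gt0 -[X in (X - _)%R]mulr1 -mulrBr mulr_gt0// subr_gt0
    ltr_pdivrMr// mul1r ltr_nat.
have lohi : (lo < hi)%R by rewrite /lo /hi -natr1; nra.
have lo0 : (0 <= lo)%R by rewrite mulr_ge0// addr_ge0//; lra.
pose A (k : nat) := `]l, (l + e)%R]%classic.
(* The service time [sigma 0] alone pushes the maximum above [lo]; all of them stay at most [hi]. *)
pose B k := if k == 0%N then `]lo, hi]%classic else `]0%R, hi]%classic.
have mA k : measurable (A k) by exact: measurable_itv.
have mB k : measurable (B k) by rewrite /B; case: ifP => _; exact: measurable_itv.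
pose E := [set w | (forall k, (k < j.+1)%N -> A k (tau k w)) /\
             (forall k, (k < i.+1)%N -> B k (sigma k w))].
have mE : measurable E by exact: measurable_product_event.
have mst : measurable (gap i j `\` gap i j.+1) by exact: measurableD.
have -> : stage_transition tau sigma i.+1 j.+1 = P (gap i j `\` gap i j.+1).
  congr (P _); apply/seteqP; split => w /= [h1 h2]; split => //.
    by apply/negP; rewrite -leNgt.
  by move: h2 => /negP; rewrite -leNgt.
apply: (@lt_le_trans _ _ (P E)); last first.
  apply: le_measure; rewrite ?inE// => w [Aw Bw].
  have Slo : (arrival_epoch tau j w <= lo)%R.
    rewrite /arrival_epoch /lo mulr_natl -[X in (_ *+ X)%R]card_ord -sumr_const.
    apply: ler_sum => k _; have := Aw k (leqW (ltn_ord k)).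
    by rewrite /A /= in_itv/= => /andP[].
  have Shi : (hi <= arrival_epoch tau j.+1 w)%R.
    rewrite /arrival_epoch /hi mulr_natl -[X in (_ *+ X)%R]card_ord -sumr_const.
    apply: ler_sum => k _; have := Aw k (ltn_ord k).
    by rewrite /A /= in_itv/= => /andP[/ltW].
  split.
    apply/lt_stage_duration; exists 0%N => //; have := Bw 0%N (ltn0Sn _).
    by rewrite /B eqxx /= in_itv/= => /andP[/(le_lt_trans Slo)].
  move=> /lt_stage_duration[k ki]; apply/negP; rewrite -leNgt.
  apply: le_trans Shi; have := Bw k ki.
  by rewrite /B; case: ifP => _; rewrite /= in_itv/= => /andP[].
rewrite independent_events//; apply: mule_gt0.
  elim/big_ind : _ => // [x y|k _]; first exact: mule_gt0.
  by rewrite tauE.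
elim/big_ind : _ => // [x y|k _]; first exact: mule_gt0.
have hi0 : (0 < hi)%R by exact: le_lt_trans lohi.
rewrite /B; case: ifP => _; apply: (exponential_interval_gt0 mu_gt0 (sigma_exp k)).
  by rewrite lo0.
by rewrite lexx.
Qed.

End StageTransition.

(** * Renumbering of the states and conclusion *)

Lemma nneseries_from1 (R : realType) (f : nat -> \bar R) :
  (forall i, 0 <= f i.+1) -> \sum_(1 <= i <oo) f i = \sum_(i <oo) f i.+1.
Proof.
(* The sign of [f 0] is unknown, so it is replaced by 0 before shifting. *)
move=> f0; pose f' i := if i is k.+1 then f k.+1 else 0.
transitivity (\sum_(1 <= i <oo) f' i).
  by apply/congr_lim/funext => n; apply: eq_big_nat => -[].
rewrite -nneseries_addn; last by case.
by apply: eq_eseriesr => i _; rewrite addn1.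
Qed.

Lemma invariant_distribution_shift (R : realType) (p : nat -> nat -> \bar R)
    (q : nat -> R) : (forall i j, 0 <= p i j) ->
  invariant_distribution p q <-> [/\ forall i, (0 <= q i.+1)%R,
    forall i, (q i.+1)%:E = kernel_push (EFin \o (q \o S)) (shift_kernel p) i &
    \sum_(i <oo) (q i.+1)%:E = 1].
Proof.
move=> p0; have sumE i : (forall k, (0 <= q k.+1)%R) ->
    \sum_(1 <= j <oo) (q j)%:E * p j i.+1 =
    kernel_push (EFin \o (q \o S)) (shift_kernel p) i.
  by move=> q0; rewrite nneseries_from1// => k; rewrite mule_ge0// lee_fin.
split=> [[q0 qp q1]|[q0 qp q1]]; split.
- by move=> i; exact: q0.
- by move=> i; rewrite qp// sumE// => k; exact: q0.
- rewrite -(nneseries_from1 (f := fun k => (q k)%:E))// => i.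
  by rewrite lee_fin q0.
- by case.
- by move=> [//|i] _; rewrite sumE.
- by rewrite nneseries_from1// => i; rewrite lee_fin.
Qed.

Theorem proposition7 (R : realType)
  (d : measure_display) (T : measurableType d) (P : probability T R)
  (tau sigma : nat -> {RV P >-> R}) (mu : R)
  (d' : measure_display) (T' : measurableType d')
  (Pr : nat -> probability T' R) (K : nat -> {mfun T' >-> nat})
  (mu_gt0 : (0 < mu)%R)
  (tau_sigma_indep : mutually_independent
     (fun k : nat + nat => match k with inl m => tau m | inr m => sigma m end))
  (tau_same_law : forall m, same_law (tau m) (tau 0%N))
  (tau_gt0 : forall m, P [set w | (0 < tau m w)%R] = 1)
  (sigma_exp : forall m, exponential_law mu (sigma m))
  (tau_second_moment : 'E_P[fun w => (tau 0%N w ^+ 2)%R] < +oo)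
  (K_chain : is_markov_chain (stage_transition tau sigma) Pr K) :
  positive_recurrent Pr K /\
  exists q : nat -> R,
    invariant_distribution (stage_transition tau sigma) q /\
    forall q' : nat -> R, invariant_distribution (stage_transition tau sigma) q' ->
      forall i : nat, (0 < i)%N -> q' i = q i.
Proof.
have p0 i j : 0 <= stage_transition tau sigma i j by exact: measure_ge0.
have p_gt0 i j : 0 < shift_kernel (stage_transition tau sigma) i j.
  exact: (stage_transition_gt0 mu_gt0 tau_sigma_indep tau_same_law tau_gt0 sigma_exp).
have p_sum i : \sum_(j <oo) shift_kernel (stage_transition tau sigma) i j = 1.
  exact: (stage_transition_sum mu_gt0 tau_sigma_indep tau_same_law tau_gt0 sigma_exp).
have [J driftJ] :=
  stage_transition_drift mu_gt0 tau_sigma_indep tau_same_law tau_gt0 sigma_exp.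
(* Index [k] is the state [k.+1], so [V] is the number of customers; [J + (k + 1) / 2 <= k] holds
   exactly from [k = 2 J + 1] on. *)
pose N := J.*2.+1; pose V k : R := k.+1%:R.
have V0 k : (0 <= V k)%R by [].
have drift k : kernel_act (shift_kernel (stage_transition tau sigma)) (EFin \o V) k <=
    (if (k < N)%N then J%:R + N%:R / 2 else V k - 1)%:E.
  apply: le_trans (driftJ k) _; case: ifPn => [kN|]; rewrite lee_fin.
    by rewrite lerD2l ler_pM2r ?invr_gt0// ler_nat.
  rewrite -leqNgt -(ler_nat R) /N -addnn -natr1 natrD /V -natr1; lra.
split.
  apply: positive_recurrent_of_survival p0 K_chain _ => i.
  exact: (taboo_survival_sum_lty p_gt0 p_sum V0 drift).
have [q [q0 qp q1]] := invariant_exists p_gt0 p_sum V0 drift.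
exists (q \o predn); split; first by apply/invariant_distribution_shift.
move=> q' /(invariant_distribution_shift _ p0)[q'0 q'p q'1] [//|i] _.
exact: (invariant_unique p_gt0 p_sum (q := q' \o S) q'0 q0 q'p qp q'1 q1).
Qed.
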